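(* Fix integers $n\ge 2$ and $d\ge 3$. Set $$\rho:=\left\lceil\frac{\binom{n+d}{n}+1}{n+1}\right\rceil.$$ Then $\mathbb{T}(n,d;x)'=\emptyset$ for all $x>\rho$.
   Context: We work over an algebraically closed field of characteristic $0$. For a finite set $S\subset\mathbb{P}^n$, $\langle S\rangle$ is its linear span, and $2S\subset\mathbb{P}^n$ is the zero-dimensional scheme defined by the ideal sheaf $(\mathcal{I}_S)^2$ (the union of the double points supported at $S$). For a closed subscheme $Z\subset\mathbb{P}^n$, $h^i(\mathcal{I}_Z(d))=\dim H^i(\mathbb{P}^n,\mathcal{I}_Z(d))$. $\mathbb{T}(n,d;x)$ is the set of all subsets $S\subset\mathbb{P}^n$ of cardinality $x$ such that $h^0(\mathcal{I}_{2S}(d))>0$, $h^1(\mathcal{I}_{2S}(d))>0$ and $\langle S\rangle=\mathbb{P}^n$. $\mathbb{T}(n,d;x)'$ (the minimally Terracini sets) is the set of all $S\in\mathbb{T}(n,d;x)$ such that $h^1(\mathcal{I}_{2A}(d))=0$ for all $A\subsetneq S$. *)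

(* Defs.v *)
From mathcomp Require Import all_boot all_order all_algebra finmap.
From mathcomp Require Import mpoly.

Set Implicit Arguments.
Unset Strict Implicit.
Unset Printing Implicit Defensive.

Import Order.TTheory GRing.Theory Num.Theory.
Local Open Scope ring_scope.

Section TerraciniSets.
Variables (K : fieldType) (n : nat).

Definition proj_space := {L : {vspace 'rV[K]_n.+1} | \dim L == 1%N}.

Definition spans_proj_space (S : {fset proj_space}) : Prop :=
  (\sum_(p <- S) val p)%VS = fullv.

Local Notation R := {mpoly K[n.+1]}.

(* The homogeneous ideal of S, as the ideal of the affine cone over S.  The
   lines contain the origin, so for S nonempty the constants are excluded. *)
Definition vanishing_ideal (S : {fset proj_space}) (f : R) : Prop :=
  forall p, p \in S -> forall v, v \in val p -> f.@[fun i => v 0 i] = 0.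

Definition ideal_prod (I J : R -> Prop) (f : R) : Prop :=
  exists m (g h : 'I_m -> R),
    [/\ forall j, I (g j), forall j, J (h j) & f = \sum_(j < m) g j * h j].

(* A graded ideal whose associated sheaf is the square of the ideal sheaf of S;
   it need not be saturated. *)
Definition double_ideal (S : {fset proj_space}) : R -> Prop :=
  ideal_prod (vanishing_ideal S) (vanishing_ideal S).

(* Cohomology of the sheaf I~(d), I a homogeneous ideal of R, as the Cech
   cohomology of the standard affine cover U_i = {x_i != 0} of P^n.  A
   multi-index sigma = (i_0, ..., i_p) is a finite function, and cochains are
   not required to be alternating.  All localizations of R, and of I, live in
   the fraction field of R. *)
Local Notation F := {fraction R}.

Definition cochain (p : nat) := {ffun {ffun 'I_p.+1 -> 'I_n.+1} -> F}.

Definition coord_prod (p : nat) (sigma : {ffun 'I_p.+1 -> 'I_n.+1}) : R :=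
  \prod_(j < p.+1) 'X_(sigma j).

(* z is a section of I~(d) on the intersection of the U_(sigma j), that is an
   element of degree d of the localization of I at coord_prod sigma. *)
Definition section (I : R -> Prop) (d p : nat)
    (sigma : {ffun 'I_p.+1 -> 'I_n.+1}) (z : F) : Prop :=
  exists k (f : R),
    [/\ I f, f \is (d + k * p.+1)%N.-homog
      & z = tofrac f / tofrac (coord_prod sigma) ^+ k].

Definition is_cochain (I : R -> Prop) (d p : nat) (s : cochain p) : Prop :=
  forall sigma, section I d sigma (s sigma).

Definition cech_diff (p : nat) (s : cochain p) : cochain p.+1 :=
  [ffun sigma : {ffun 'I_p.+2 -> 'I_n.+1} =>
     \sum_(k < p.+2) (-1) ^+ k * s [ffun j : 'I_p.+1 => sigma (lift k j)]].

Definition cocycle (I : R -> Prop) (d p : nat) (s : cochain p) : Prop :=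
  is_cochain I d s /\ cech_diff s = 0.

Definition coboundary (I : R -> Prop) (d p : nat) : cochain p -> Prop :=
  match p return cochain p -> Prop with
  | 0 => fun s => s = 0
  | q.+1 => fun s => exists2 t : cochain q, is_cochain I d t & s = cech_diff t
  end.

Definition lincomb (p m : nat) (c : 'rV[K]_m) (v : 'I_m -> cochain p) :
    cochain p :=
  [ffun sigma => \sum_(j < m) tofrac (c 0 j)%:MP * v j sigma].

(* h^p(P^n, I~(d)) = m : the classes of some m cocycles form a K-basis of
   cocycles modulo coboundaries. *)
Definition cohom_dim (p : nat) (I : R -> Prop) (d m : nat) : Prop :=
  exists v : 'I_m -> cochain p,
    (forall j, cocycle I d (v j)) /\
    (forall z, cocycle I d z ->
       exists! c : 'rV[K]_m, coboundary I d (z - lincomb c v)).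

Definition terracini (d x : nat) (S : {fset proj_space}) : Prop :=
  [/\ #|` S|%fset = x,
      exists2 m, (0 < m)%N & cohom_dim 0 (double_ideal S) d m,
      exists2 m, (0 < m)%N & cohom_dim 1 (double_ideal S) d m
    & spans_proj_space S].

Definition min_terracini (d x : nat) (S : {fset proj_space}) : Prop :=
  terracini d x S /\
  forall A : {fset proj_space}, (A `<` S)%fset ->
    cohom_dim 1 (double_ideal A) d 0.

End TerraciniSets.

Definition rho (n d : nat) : int :=
  Num.ceil (('C(n + d, n)%:R + 1) / n.+1%:R : rat).

(* Main.v *)
Require Import Defs.
From mathcomp Require Import all_boot all_order all_algebra finmap.
From mathcomp Require Import mpoly.
From mathcomp Require Import ring.

(** Let A be S with one point removed, so that A has at least rho points.  If
    S were minimally Terracini, then h^1(I_2A(d)) = 0, hence the double points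
    at A would impose (n+1)|A| independent conditions on the forms of degree d,
    and (n+1)|A| <= C(n+d,n) by [H1_zero_card].  But
    (n+1) rho >= C(n+d,n) + 1, a contradiction.

    The content is therefore the passage from the vanishing of a Cech H^1 to
    the independence of the conditions, that is, the surjectivity of
    H^0(O(d)) -> H^0(O_2A(d)).  It has three ingredients.

    Surjectivity itself ([cech_H1_lift]): local fractions P_i / x_i^N of degree
    d whose differences lie in the ideal I define a 1-cocycle of I~(d).  If
    this cocycle is the coboundary of some t, the fractions P_i / x_i^N - t_i
    coincide, and they glue to a form of degree d ([glue_forms]).

    Enough sections of O_2A(d) ([local_lifts]): for each point p of A, sections
    supported at p realizing all first-order germs at p.  The ideal I(A)^2 need
    not be saturated, so a form vanishing to order two along A may lie outside
    it; the local lifts are given by an explicit formula, from which their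
    differences are seen to be in I(A)^2.

    Independence ([H1_zero_card]): the (n+1)|A| resulting forms are linearly
    independent, since a relation between them, restricted to the first-order
    neighbourhood of p, says that a linear form has zero gradient there. *)

Set Implicit Arguments.
Unset Strict Implicit.
Unset Printing Implicit Defensive.

Import Order.TTheory GRing.Theory Num.Theory.
Local Open Scope ring_scope.

(** * General algebra *)

Lemma eq_sub_swap (V : zmodType) (a b c e : V) : b - a = e - c -> a - c = b - e.
Proof.
move=> ba; have -> : b = e - c + a by rewrite -ba subrK.
by rewrite addrAC (addrAC e) subrr add0r addrC.
Qed.

Lemma sub_frac (L : fieldType) (a b c e : L) : c != 0 -> e != 0 ->
  a / c - b / e = (a * e - b * c) / (e * c).
Proof. by move=> c0 e0; field; rewrite c0 e0. Qed.

Lemma sub_frac_mul (L : fieldType) (a b c e : L) : c != 0 -> e != 0 ->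
  e * a - c * b = (a / c - b / e) * (e * c).
Proof. by move=> c0 e0; field; rewrite c0 e0. Qed.

Lemma card_free_family (K : fieldType) (V : vectType K) (T : finType) (g : T -> V) :
  (forall c : T -> K, \sum_x c x *: g x = 0 -> forall x, c x = 0) ->
  (#|T| <= \dim {:V})%N.
Proof.
move=> free_g; pose X := [tuple g (enum_val i) | i < #|T|].
have /eqnP : free X.
  apply/freeP => c sum_c i.
  suff /free_g/(_ (enum_val i)) : \sum_x c (enum_rank x) *: g x = 0.
    by rewrite enum_valK.
  rewrite -[RHS]sum_c (eq_bigl (mem T)) // big_enum_val; apply: eq_bigr => j _.
  by rewrite enum_valK -tnth_nth tnth_mktuple.
by rewrite size_tuple => <-; apply: dimvS; apply: subvf.
Qed.

(** * Forms and their singular points *)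

Section Forms.
Variables (K : fieldType) (n : nat).
Local Notation R := {mpoly K[n.+1]}.
Implicit Types (f g : R).

Lemma meval_dhomog d (f : R) (c : K) (v : 'I_n.+1 -> K) :
  f \is d.-homog -> f.@[fun i => c * v i] = c ^+ d * f.@[v].
Proof.
move=> /dhomogP hf; rewrite !mevalE big_distrr /= !big_seq.
apply: eq_bigr => m /hf; rewrite /= mdegE => <-.
rewrite mulrCA expr_sum -big_split /=; congr (_ * _).
by apply: eq_bigr => i _; rewrite exprMn.
Qed.

Lemma dhomogX1 i : ('X_i : R) \is 1.-homog.
Proof. by rewrite dhomogX; apply/eqP; exact: mdeg1. Qed.

Lemma dhomog_const_mul d (c : K) (f : R) :
  f \is d.-homog -> c%:MP * f \is d.-homog.
Proof. by rewrite mul_mpolyC; apply: dhomogZ. Qed.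

Lemma mpolyX1_neq0 i k : ('X_i : R) ^+ k != 0.
Proof. by rewrite expf_neq0 // -msupp_eq0 msuppX. Qed.

(** For f homogeneous and v representing a point, this is membership of f in
    the square of the ideal of the point.  By Euler's relation the gradient
    determines the value only when the degree of f is invertible in K, whence
    the separate condition on the value. *)
Definition singular_at (v : 'rV[K]_n.+1) (f : R) : Prop :=
  f.@[v 0] = 0 /\ forall j, f^`M(j).@[v 0] = 0.

Lemma singular_at0 (v : 'rV[K]_n.+1) : singular_at v 0.
Proof. by split=> [|j]; rewrite ?mderiv0 meval0. Qed.

Lemma singular_atD (v : 'rV[K]_n.+1) f g :
  singular_at v f -> singular_at v g -> singular_at v (f + g).
Proof.
move=> [f0 f1] [g0 g1]; split=> [|j]; rewrite ?mderivD mevalD.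
  by rewrite f0 g0 addr0.
by rewrite f1 g1 addr0.
Qed.

Lemma singular_at_sum (v : 'rV[K]_n.+1) (I : Type) (r : seq I) (P : pred I)
    (F : I -> R) :
  (forall i, P i -> singular_at v (F i)) ->
  singular_at v (\sum_(i <- r | P i) F i).
Proof.
move=> sF; apply: (big_ind (singular_at v)) => //; first exact: singular_at0.
exact: singular_atD.
Qed.

Lemma singular_atMl (v : 'rV[K]_n.+1) f g : singular_at v g -> singular_at v (f * g).
Proof.
move=> [g0 g1]; split=> [|j]; rewrite ?mderivM ?mevalD !mevalM g0 mulr0 //.
by rewrite g1 mulr0 addr0.
Qed.

Lemma singular_atM (v : 'rV[K]_n.+1) f g :
  f.@[v 0] = 0 -> g.@[v 0] = 0 -> singular_at v (f * g).
Proof.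
move=> f0 g0; split=> [|j]; rewrite ?mderivM ?mevalD !mevalM f0 g0 ?mul0r //.
by rewrite mulr0 addr0.
Qed.

(** A function that does not vanish at v is invertible near v, so it can be
    cleared from an equation singular at v; this is how denominators are
    removed. *)
Lemma singular_at_cancel (v : 'rV[K]_n.+1) f g :
  f.@[v 0] != 0 -> singular_at v (f * g) -> singular_at v g.
Proof.
move=> f_neq0 [fg0 fg1].
have g0 : g.@[v 0] = 0.
  by move/eqP: fg0; rewrite mevalM mulf_eq0 (negbTE f_neq0) => /eqP.
split=> // j; move/eqP: (fg1 j).
by rewrite mderivM mevalD !mevalM g0 mulr0 add0r mulf_eq0 (negbTE f_neq0) => /eqP.
Qed.

(** * Points, separating forms and the squared ideal *)

Implicit Types (p q : proj_space K n) (A : {fset proj_space K n}).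

Definition rep p : 'rV[K]_n.+1 := vpick (val p).

Lemma val_rep p : val p = <[rep p]>%VS.
Proof.
have dimp : \dim (val p) = 1%N := eqP (valP p).
have rep_neq0 : rep p != 0.
  by rewrite /rep vpick0 -dimv_eq0 dimp.
apply/esym/eqP; rewrite eqEdim dimp dim_vline rep_neq0 andbT.
by rewrite -memvE memv_pick.
Qed.

Lemma rep_coord_neq0 p : exists i, rep p 0 i != 0.
Proof.
have dimp : \dim (val p) = 1%N := eqP (valP p).
apply/existsP; apply: contraT; rewrite negb_exists => /forallP rep0.
suff rp : rep p = 0 by move: dimp; rewrite val_rep rp dim_vline eqxx.
by apply/rowP => i; rewrite mxE; move/eqP: (negbNE (rep0 i)).
Qed.

(** Let q_j0 be nonzero.  If all minors p_i q_j0 - p_j0 q_i vanish, then p is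
    proportional to q; if one does not, the linear form q_j0 X_i - q_i X_j0
    takes this value at p, and it vanishes at q. *)
Lemma separating_form p q : exists l : R,
  [/\ l \is 1.-homog, l.@[rep p 0] = 1 & q != p -> l.@[rep q 0] = 0].
Proof.
have [i0 pi0] := rep_coord_neq0 p; have [j0 qj0] := rep_coord_neq0 q.
have [->|qp] := eqVneq q p.
  exists ((rep p 0 i0)^-1%:MP * 'X_i0); split=> //.
    exact/dhomog_const_mul/dhomogX1.
  by rewrite mevalM mevalC mevalXU mulVf.
pose mnr i := rep p 0 i * rep q 0 j0 - rep p 0 j0 * rep q 0 i.
have [i mi] : exists i, mnr i != 0.
  apply/existsP; apply: contraNT qp; rewrite negb_exists => /forallP mnr0.
  have pq : rep p = (rep p 0 j0 / rep q 0 j0) *: rep q.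
    apply/rowP => i; rewrite mxE mulrAC; apply: (canRL (mulfK qj0)).
    by move/eqP/subr0_eq: (negbNE (mnr0 i)).
  apply/eqP/val_inj; rewrite (val_rep p) (val_rep q) pq.
  apply/eqP; rewrite eq_sym eqEdim !dim_vline -pq.
  have -> : rep p != 0 by apply: contraNneq pi0 => ->; rewrite mxE.
  by rewrite leq_b1 andbT -memvE pq memvZ ?memv_line.
exists ((mnr i)^-1%:MP * ((rep q 0 j0)%:MP * 'X_i - (rep q 0 i)%:MP * 'X_j0)).
split.
- by apply/dhomog_const_mul/rpredB; apply/dhomog_const_mul/dhomogX1.
- rewrite mevalM mevalB !mevalM !mevalC !mevalXU mulrC.
  apply: (canLR (mulfK _)) => //.
  by rewrite mul1r /mnr; ring.
- move=> _; rewrite mevalM mevalB !mevalM !mevalC !mevalXU.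
  by rewrite [X in _ * (X - _)]mulrC subrr mulr0.
Qed.

(** A product of separating forms.  The parameter d makes the degree as large
    as wanted, even when s is empty. *)
Lemma isolating_form p d (s : seq (proj_space K n)) : exists E : R,
  [/\ E \is (d + size s).-homog, E.@[rep p 0] = 1
    & forall q, q \in s -> q != p -> E.@[rep q 0] = 0].
Proof.
elim: s => [|q s [E [hE Ep Es]]].
  have [l [hl lp _]] := separating_form p p; exists (l ^+ d).
  rewrite rmorphXn /= lp expr1n addn0; split=> //.
  by rewrite -[X in X.-homog]mul1n; apply: dhomogMn.
have [l [hl lp lq]] := separating_form p q; exists (l * E); split.
- by rewrite addnS -[X in X.-homog]add1n; apply: dhomogM.
- by rewrite mevalM lp Ep mulr1.
- move=> q'; rewrite inE mevalM => /predU1P[->|q's] q'p.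
    by rewrite lq // mul0r.
  by rewrite Es // mulr0.
Qed.

Lemma vanishing_ideal_dhomog A d (f : R) : f \is d.+1.-homog ->
  (forall p, p \in A -> f.@[rep p 0] = 0) -> vanishing_ideal A f.
Proof.
move=> hf fA p pA v; rewrite val_rep => /vlineP[c ->].
under meval_eq do rewrite mxE.
by rewrite (meval_dhomog _ _ hf) fA // mulr0.
Qed.

Lemma double_ideal_singular A (f : R) p :
  double_ideal A f -> p \in A -> singular_at (rep p) f.
Proof.
move=> [m [g [h [gA hA ->]]]] pA.
have rep_p : rep p \in val p by rewrite val_rep memv_line.
apply: singular_at_sum => j _.
apply: singular_atM; first exact: (gA j _ pA).
exact: (hA j _ pA).
Qed.

Lemma vanishing_idealM A (f g : R) :
  vanishing_ideal A g -> vanishing_ideal A (f * g).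
Proof. by move=> gA p pA v vp; rewrite mevalM (gA p) // mulr0. Qed.

Lemma double_idealM A (f g : R) : double_ideal A g -> double_ideal A (f * g).
Proof.
move=> [m [a [b [aA bA ->]]]]; exists m, (fun j => f * a j), b.
split=> //; first by move=> j; apply: vanishing_idealM.
by rewrite mulr_sumr; apply: eq_bigr => j _; rewrite mulrA.
Qed.

Lemma double_ideal_mul A (f g : R) :
  vanishing_ideal A f -> vanishing_ideal A g -> double_ideal A (f * g).
Proof. by move=> fA gA; exists 1, (fun=> f), (fun=> g); rewrite big_ord1. Qed.

Lemma double_idealD A (f g : R) :
  double_ideal A f -> double_ideal A g -> double_ideal A (f + g).
Proof.
move=> [m [a [b [aA bA ->]]]] [m' [a' [b' [aA' bA' ->]]]].
exists (m + m')%N.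
exists (fun j => match split j with inl i => a i | inr i => a' i end).
exists (fun j => match split j with inl i => b i | inr i => b' i end).
split=> [j|j|]; try by case: (split j).
rewrite big_split_ord; congr (_ + _); apply: eq_bigr => j _.
  by rewrite -[lshift _ _]/(unsplit (inl j)) unsplitK.
by rewrite -[rshift _ _]/(unsplit (inr j)) unsplitK.
Qed.

(** For every linear form l, the fractions P_i l / X_i^N of degree d are lifts,
    on the standard charts, of one and the same section of O_2A(d) supported
    at p.  Their compatibility on overlaps is stated without denominators,
    modulo I(A)^2 itself.

    Let E isolate p in A, and let y be a linear form with y(v) = 1, where v is
    the representative of p.  A section at p is E^2 l y^(-k), of degree d for a
    suitable k, but y is not invertible on the charts; to first order at p it
    can be replaced.  Put e_i = 1 - v_i y / X_i, which vanishes at p if p lies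
    on the chart.  Then u_i = v_i (2 X_i - v_i y) / X_i^2 satisfies
    y u_i = 1 - e_i^2, so u_i is then an inverse of y modulo the square of the
    ideal of p.  On all overlaps,
      u_j - u_i = u_j (1 - y u_i) - u_i (1 - y u_j) = u_j e_i^2 - u_i e_j^2.
    Hence E^2 (u_j - u_i) is a combination of the squares of E e_i and E e_j,
    which vanish on A; and u_j - u_i divides u_j^k - u_i^k.  So
    P_i = E^2 (X_i^2 u_i)^k and N = 2k work.  When v_i = 0 the formula gives
    u_i = 0, the right lift on a chart that does not contain p. *)
Lemma local_lifts A p d : exists N (P : 'I_n.+1 -> R),
  [/\ forall i (l : R), l \is 1.-homog -> P i * l \is (d + N).-homog,
      forall i q, q \in A -> q != p -> singular_at (rep q) (P i),
      forall i, (P i).@[rep p 0] = rep p 0 i ^+ N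
    & forall i j, double_ideal A (P j * 'X_i ^+ N - P i * 'X_j ^+ N)].
Proof.
have [E [hE Ep EA]] := isolating_form p d A.
have [y [hy yp _]] := separating_form p p.
pose v i := rep p 0 i.
(* E ^+ 2 * w i ^+ k * l has degree 2m + k + 1, which must be d + 2k; the
   summand d of m ensures that this has a solution k. *)
pose m := (d + size A)%N; pose k := (d + (size A).*2).+1.
(* In the notation above, w i = X_i^2 u_i and t i = X_i e_i. *)
pose w i : R := (v i)%:MP * ('X_i + 'X_i - (v i)%:MP * y).
pose t i : R := 'X_i - (v i)%:MP * y.
have hw i : w i \is 1.-homog.
  apply/dhomog_const_mul/rpredB; last exact: dhomog_const_mul.
  by apply: rpredD; exact: dhomogX1.
have wp i : (w i).@[rep p 0] = v i ^+ 2.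
  by rewrite !(mevalM, mevalB, mevalD, mevalC, mevalXU) yp -/(v i); ring.
have wt i j : w i * 'X_j ^+ 2 - w j * 'X_i ^+ 2
    = w i * t j ^+ 2 - w j * t i ^+ 2 by rewrite /w /t; ring.
have Et i : vanishing_ideal A (E * t i).
  have ht : t i \is 1.-homog.
    by apply: rpredB; [apply: dhomogX1 | apply: dhomog_const_mul].
  apply: (@vanishing_ideal_dhomog _ m).
    by rewrite -[X in X.-homog]addn1; apply: dhomogM.
  move=> q qA; rewrite mevalM; have [->|qp] := eqVneq q p.
    by rewrite mevalB mevalXU mevalM mevalC yp mulr1 subrr mulr0.
  by rewrite EA // mul0r.
exists k.*2, (fun i => E ^+ 2 * w i ^+ k); split.
- move=> i l hl; have -> : (d + k.*2 = m * 2 + 1 * k + 1)%N.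
    by rewrite /k /m mul1n -!addnn; ring.
  by apply: dhomogM => //; apply: dhomogM; apply: dhomogMn.
- move=> i q qA qp; rewrite mulrC expr2.
  by apply/singular_atMl/singular_atM; apply: EA.
- by move=> i; rewrite mevalM !rmorphXn /= Ep wp expr1n mul1r -exprM mul2n.
- move=> i j; pose a := w j * 'X_i ^+ 2; pose b := w i * 'X_j ^+ 2.
  pose Q := \sum_(r < k) a ^+ (k.-1 - r) * b ^+ r.
  have -> : E ^+ 2 * w j ^+ k * 'X_i ^+ k.*2 - E ^+ 2 * w i ^+ k * 'X_j ^+ k.*2
      = Q * w j * ((E * t i) * (E * t i)) + (- Q * w i) * ((E * t j) * (E * t j)).
    have -> : Q * w j * ((E * t i) * (E * t i)) +
        (- Q * w i) * ((E * t j) * (E * t j))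
      = E ^+ 2 * ((w j * t i ^+ 2 - w i * t j ^+ 2) * Q) by ring.
    have expE (e u z : R) : e * (u * z ^+ 2) ^+ k = e * u ^+ k * z ^+ k.*2.
      by rewrite exprMn -exprM mul2n mulrA.
    have abQ : a ^+ k - b ^+ k = (w j * t i ^+ 2 - w i * t j ^+ 2) * Q.
      by rewrite -wt; exact: subrXX.
    by rewrite -(expE _ (w j) 'X_i) -(expE _ (w i) 'X_j) -mulrBr abQ.
  by apply: double_idealD; apply/double_idealM/double_ideal_mul.
Qed.

(** * Gluing forms *)

(** Distinct variables are coprime: multiplying f by a power of X_j does not
    change the exponents of X_i in its monomials. *)
Lemma mpoly_dvd_varX (f g : R) i j a b : i != j ->
  f * 'X_j ^+ b = g * 'X_i ^+ a -> exists h, f = h * 'X_i ^+ a.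
Proof.
move=> ij fg; rewrite !mpolyXn in fg *.
have le_a m : m \in msupp f -> (U_(i) *+ a <= m)%MM.
  move=> mf; have : (U_(j) *+ b + m)%MM \in msupp (g * 'X_[U_(i) *+ a]).
    by rewrite -fg mcoeff_msupp mcoeffMX -mcoeff_msupp.
  rewrite (perm_mem (msuppMX _ _)) => /mapP[m' _ /mnmP /(_ i) e].
  apply/mnm_lepP => l; rewrite mulmnE mnm1E; case: eqP => [<-|_]; last first.
    by rewrite mul0n.
  rewrite mul1n; move: e.
  rewrite !mnmDE !mulmnE !mnm1E eqxx eq_sym (negbTE ij) mul0n add0n mul1n => ->.
  by rewrite leq_addr.
exists (\sum_(m <- msupp f) f@_m *: 'X_[m - U_(i) *+ a]).
rewrite [LHS]mpolyE mulr_suml !big_seq; apply: eq_bigr => m /le_a am.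
by rewrite -scalerAl -mpolyXD submK.
Qed.

(** This is H^0(P^n, O(d)) = K[X_0, ..., X_n]_d, for n > 0: a common value of
    the fractions f_i / X_i^(k_i) has no denominator, since two different charts
    give denominators that are powers of two different variables. *)
Lemma glue_forms d (k : 'I_n.+1 -> nat) (f : 'I_n.+1 -> R) : (0 < n)%N ->
  (forall i, f i \is (d + k i).-homog) ->
  (forall i j, f i * 'X_j ^+ k j = f j * 'X_i ^+ k i) ->
  exists2 G : R, G \is d.-homog & forall i, f i = G * 'X_i ^+ k i.
Proof.
move=> n_gt0 hf ff.
have ij : ord0 != ord_max :> 'I_n.+1.
  by rewrite -val_eqE /= eq_sym -lt0n.
have [G fG] := mpoly_dvd_varX ij (ff _ _).
exists G => [|i].
  apply/dhomogP => m mG; have /dhomogP/(_ (U_(ord0) *+ k ord0 + m)%MM) := hf ord0.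
  rewrite fG mpolyXn mcoeff_msupp mcoeffMX -mcoeff_msupp => /(_ mG).
  by rewrite /= mdegD mdegMn mdeg1 mul1n addnC => /addIn.
apply: (mulIf (mpolyX1_neq0 ord0 (k ord0))).
by rewrite ff fG mulrAC.
Qed.

(** * The first Cech cohomology group *)

Definition vertex (i : 'I_n.+1) : {ffun 'I_1 -> 'I_n.+1} := [ffun=> i].

Lemma cech_diff0E (s : cochain K n 0) (sigma : {ffun 'I_2 -> 'I_n.+1}) :
  cech_diff s sigma = s (vertex (sigma ord_max)) - s (vertex (sigma ord0)).
Proof.
rewrite /cech_diff ffunE big_ord_recl big_ord1 expr0 mul1r /= expr1 mulN1r.
by congr (s _ - s _); apply/ffunP => r; rewrite !ffunE (ord1 r);
  congr (sigma _); apply: val_inj.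
Qed.

Lemma cech_diff_diff0 (s : cochain K n 0) : cech_diff (cech_diff s) = 0.
Proof.
apply/ffunP => sigma; rewrite [in LHS]ffunE !big_ord_recl big_ord0.
rewrite !cech_diff0E !ffunE /=.
have e0 : lift ord0 (ord_max : 'I_2) = ord_max :> 'I_3 by apply: val_inj.
have e1 : lift (lift ord0 ord0) (ord_max : 'I_2) = ord_max :> 'I_3 by apply: val_inj.
have e2 : lift (lift ord0 (lift ord0 ord0)) (ord_max : 'I_2)
  = lift ord0 ord0 :> 'I_3 by apply: val_inj.
have e3 : lift (lift ord0 ord0) (ord0 : 'I_2) = ord0 :> 'I_3 by apply: val_inj.
have e4 : lift (lift ord0 (lift ord0 ord0)) (ord0 : 'I_2)
  = ord0 :> 'I_3 by apply: val_inj.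
rewrite e0 e1 e2 e3 e4 /bump /= !exprS expr0; ring.
Qed.

(** Surjectivity of H^0(O(d)) -> H^0((O/I~)(d)) when H^1(I~(d)) = 0.  The local
    sections P_i / X_i^N of O(d) agree modulo I on overlaps, so they form a
    global section of the quotient; G lifts it, up to the power of X_i which
    accounts for the localization of I. *)
Lemma cech_H1_lift (I : R -> Prop) d N (P : 'I_n.+1 -> R) : (0 < n)%N ->
  (forall f g, I g -> I (f * g)) -> cohom_dim 1 I d 0 ->
  (forall i, P i \is (d + N).-homog) ->
  (forall i j, I (P j * 'X_i ^+ N - P i * 'X_j ^+ N)) ->
  exists2 G : R, G \is d.-homog
    & forall i, exists M, I ('X_i ^+ M * (P i - G * 'X_i ^+ N)).
Proof.
move=> n_gt0 IM [v [_ H1]] hP IP.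
pose s : cochain K n 0 := [ffun sigma : {ffun 'I_1 -> 'I_n.+1} =>
  tofrac (P (sigma ord0)) / tofrac 'X_(sigma ord0) ^+ N].
have X_neq0 i : tofrac ('X_i : R) != 0.
  by rewrite tofrac_eq0 -[X in X != 0]expr1 mpolyX1_neq0.
have sE i : s (vertex i) = tofrac (P i) / tofrac 'X_i ^+ N by rewrite !ffunE.
have z_cocycle : cocycle I d (cech_diff s).
  split; last exact: cech_diff_diff0.
  move=> sigma; pose i := sigma ord0; pose j := sigma ord_max.
  exists N, (P j * 'X_i ^+ N - P i * 'X_j ^+ N); split; first exact: IP.
    rewrite muln2 -addnn addnA.
    by apply: rpredB; apply: dhomogM => //; rewrite -[X in X.-homog]mul1n;
      apply/dhomogMn/dhomogX1.
  rewrite cech_diff0E !sE -/i -/j.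
  have -> : coord_prod K sigma = 'X_i * 'X_j.
    by rewrite /coord_prod big_ord_recl big_ord1;
      congr (_ * 'X_(sigma _)); apply: val_inj.
  rewrite tofracM exprMn tofracB !tofracM !tofracXn.
  by rewrite (sub_frac _ _ (expf_neq0 _ (X_neq0 j)) (expf_neq0 _ (X_neq0 i))).
(* The basis of H^1 is empty, so the cocycle itself is a coboundary. *)
have [c [cob _]] := H1 _ z_cocycle.
have [t tI st] : exists2 t, is_cochain I d t & cech_diff s = cech_diff t.
  case: cob => t tI st; exists t => //.
  rewrite -st [lincomb _ _](_ : _ = 0) ?subr0 //.
  by apply/ffunP => sigma; rewrite !ffunE big_ord0.
have /fin_all_exists[k /fin_all_exists[T HT]] i := tI (vertex i).
pose u i := s (vertex i) - t (vertex i).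
have u_const i j : u i = u j.
  pose e : {ffun 'I_2 -> 'I_n.+1} := [ffun r => if r == ord0 then i else j].
  have ei : e ord0 = i by rewrite ffunE.
  have ej : e ord_max = j by rewrite ffunE.
  have := congr1 (fun w : cochain K n 1 => w e) st.
  by rewrite /= !cech_diff0E ei ej; apply: eq_sub_swap.
pose f i := 'X_i ^+ k i * P i - 'X_i ^+ N * T i.
have fE i : tofrac (f i) = u i * tofrac 'X_i ^+ (k i + N).
  have [_ _] := HT i; rewrite /u sE => ->.
  rewrite /coord_prod big_ord1 ffunE /f tofracB !tofracM !tofracXn exprD.
  by rewrite (sub_frac_mul _ _ (expf_neq0 _ (X_neq0 i)) (expf_neq0 _ (X_neq0 i))).
have hf i : f i \is (d + (k i + N)).-homog.
  have hX m : ('X_i : R) ^+ m \is m.-homog.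
    by rewrite -[X in X.-homog]mul1n; apply/dhomogMn/dhomogX1.
  have [_ hT _] := HT i; rewrite muln1 in hT.
  apply: rpredB; first by rewrite addnCA; apply: dhomogM.
  by rewrite addnA addnC; apply: dhomogM.
have [|G hG fG] := glue_forms n_gt0 hf.
  move=> i j; apply/eqP; rewrite -tofrac_eq !tofracM !tofracXn !fE.
  by rewrite (u_const i j) mulrAC.
exists G => // i; exists (k i).
have [IT _ _] := HT i.
have -> : 'X_i ^+ k i * (P i - G * 'X_i ^+ N) = 'X_i ^+ N * T i; last exact: IM.
have := fG i; rewrite /f exprD => e.
by apply/eqP; rewrite mulrBr subr_eq addrC -subr_eq e mulrCA mulrA.
Qed.

(** * Independence of the conditions *)

Lemma dim_dhomog d : \dim {: dhomog n.+1 K d} = 'C(n + d, n).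
Proof. by rewrite dimvf -[LHS]/('C(d + n, d)) addnC -bin_sub ?leq_addl // addnK. Qed.

Lemma mderiv_linear_form (c : 'I_n.+1 -> K) j (v : 'I_n.+1 -> K) :
  ((\sum_i c i *: ('X_i : R))^`M(j)).@[v] = c j.
Proof.
have dX i : (c i *: ('X_i : R))^`M(j) = if i == j then (c j)%:MP else 0.
  rewrite mderivZ mderivX mnm1E; case: eqP => [->|_]; last first.
    by rewrite scale0r scaler0.
  by rewrite -[X in (X - _)%MM]add0m addmK mpolyX0 scale1r alg_mpolyC.
rewrite (raddf_sum (mderiv j)) (eq_bigr _ (fun i _ => dX i)) -big_mkcond.
by rewrite big_pred1_eq mevalC.
Qed.

(** For each point p of A and each variable X_j, the section of O_2A(d) with
    germ X_j at p, up to an invertible factor common to all j, and germ 0 at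
    the other points lifts to a form g (p, j) of degree d.  In a relation between these forms, the terms of the points other
    than p are singular at p, hence so are the terms of p, and then the linear
    form with coefficients c (p, j) is singular at p; its coefficients are its
    partial derivatives. *)
Lemma H1_zero_card (A : {fset proj_space K n}) d : (0 < n)%N ->
  cohom_dim 1 (double_ideal A) d 0 -> (n.+1 * #|` A| <= 'C(n + d, n))%N.
Proof.
move=> n_gt0 H1.
have /fin_all_exists[N /fin_all_exists[P HP]] (p : A) := local_lifts A (val p) d.
have lift_ex (x : A * 'I_n.+1) : exists g : dhomog n.+1 K d, forall i, exists M,
    double_ideal A ('X_i ^+ M * (P x.1 i * 'X_x.2 - val g * 'X_i ^+ N x.1)).
  have [hP _ _ PA] := HP x.1.
  have [|i j|G hG GP] :=
    @cech_H1_lift _ d (N x.1) (fun i => P x.1 i * 'X_x.2) n_gt0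
      (@double_idealM A) H1.
  - by move=> i; apply/hP/dhomogX1.
  - by rewrite mulrAC (mulrAC (P x.1 i)) -mulrBl mulrC; apply: double_idealM.
  - by exists (DHomog hG).
have {lift_ex} /fin_all_exists[g g_lift] := lift_ex.
have g_sing x i q : q \in A -> rep q 0 i != 0 ->
    singular_at (rep q) (P x.1 i * 'X_x.2 - val (g x) * 'X_i ^+ N x.1).
  move=> qA qi; have [M /double_ideal_singular/(_ qA)] := g_lift x i.
  by apply: singular_at_cancel; rewrite rmorphXn /= mevalXU expf_neq0.
have g_other x (q : A) : q != x.1 -> singular_at (rep (val q)) (val (g x)).
  move=> qx; have [i qi] := rep_coord_neq0 (val q).
  have [_ Psing _ _] := HP x.1.
  have PX : singular_at (rep (val q)) ('X_x.2 * P x.1 i).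
    by apply/singular_atMl/Psing; [exact: valP | rewrite (inj_eq val_inj)].
  apply: (@singular_at_cancel _ ('X_i ^+ N x.1)).
    by rewrite rmorphXn /= mevalXU expf_neq0.
  have split_lift (u y G m : R) : m * G = y * u + (-1) * (u * y - G * m) by ring.
  rewrite (split_lift (P x.1 i) 'X_x.2).
  by apply: (singular_atD PX); apply/singular_atMl/g_sing/qi/valP.
have := @card_free_family _ (dhomog n.+1 K d) _ g.
rewrite dim_dhomog card_prod card_ord -cardfE mulnC; apply => c sum_c [p j0] /=.
have [i pi] := rep_coord_neq0 (val p).
have [_ _ Pp _] := HP p.
have own_sing : singular_at (rep (val p)) (\sum_j c (p, j) *: val (g (p, j))).
  have -> : \sum_j c (p, j) *: val (g (p, j)) =
      - \sum_(x : A * 'I_n.+1 | x.1 != p) c x *: val (g x).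
    apply/eqP; rewrite -addr_eq0; apply/eqP.
    have := congr1 val sum_c.
    rewrite linear0 linear_sum (bigID (fun x => x.1 == p)) /= => sum_c0.
    rewrite -[RHS]sum_c0; congr (_ + _).
    rewrite [RHS](reindex_onto (pair p) snd) /=.
      by apply: eq_big => [j|j _]; rewrite ?eqxx.
    by case=> q j /= /eqP ->.
  rewrite -mulN1r; apply/singular_atMl/singular_at_sum => x xp.
  by rewrite -mul_mpolyC; apply/singular_atMl/g_other; rewrite eq_sym.
suff [_ /(_ j0)] : singular_at (rep (val p)) (\sum_j c (p, j) *: ('X_j : R)).
  by rewrite mderiv_linear_form.
apply: (@singular_at_cancel _ (P p i)); first by rewrite Pp expf_neq0.
have -> : P p i * \sum_j c (p, j) *: 'X_j =
    'X_i ^+ N p * (\sum_j c (p, j) *: val (g (p, j)))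
    + \sum_j (c (p, j))%:MP * (P p i * 'X_j - val (g (p, j)) * 'X_i ^+ N p).
  have split_lift (e u y G m : R) : u * (e * y) = m * (e * G) + e * (u * y - G * m).
    by ring.
  rewrite !mulr_sumr -big_split; apply: eq_bigr => j _ /=.
  by rewrite -!mul_mpolyC; exact: split_lift.
apply: singular_atD; first exact: singular_atMl.
apply: singular_at_sum => j _; apply/singular_atMl/(g_sing (p, j)) => //.
exact: valP.
Qed.

End Forms.

Theorem proposition3p4 (K : closedFieldType) (charK : [pchar K] =i pred0)
    (n d : nat) (n_ge2 : (2 <= n)%N) (d_ge3 : (3 <= d)%N)
    (x : nat) (x_gt : rho n d < x%:Z) (S : {fset proj_space K n}) :
  ~ min_terracini d x S.
Proof.
move=> [[cardS _ _ _] minS].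
have x_gt0 : (0 < x)%N.
  rewrite -ltz_nat; apply: le_lt_trans x_gt.
  by rewrite /rho ceil_ge0 (lt_le_trans (ltrN10 _)) // divr_ge0 ?addr_ge0 ?ler0n.
have rho_bound : ('C(n + d, n) < n.+1 * x.-1)%N.
  have : rho n d <= x.-1%:Z by rewrite -ltzD1 -PoszD addn1 prednK.
  rewrite /rho ceil_le_int ler_pdivrMr ?ltr0Sn // natr1.
  by rewrite -pmulrn -natrM ler_nat mulnC.
have [p pS] : exists p, p \in S.
  by apply/fset0Pn; rewrite -cardfs_gt0 cardS.
have := H1_zero_card (ltnW n_ge2) (minS _ (fproperD1 pS)).
have := cardfsD1 p S; rewrite cardS pS add1n => xE.
by rewrite leqNgt => /negP; apply; move: rho_bound; rewrite xE.
Qed.
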